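(* Let $m\ge0$ be an integer, let $\alpha>m-1$ be real, and let $n\ge m$ be an integer. Then the type II exceptional Laguerre polynomial $L^{\mathrm{II}(\alpha)}_{m,n}$ has exactly $n-m$ regular zeros, i.e. exactly $n-m$ zeros in $(0,\infty)$.
   Context: For real $\alpha$ and integer $n\ge 0$, $L^{(\alpha)}_n(z)=\sum_{k=0}^n \binom{n+\alpha}{n-k}\frac{(-z)^k}{k!}$ is the classical Laguerre polynomial (generalized binomial coefficients), and $L^{(\alpha)}_{-1}:=0$. Put $\eta_{\alpha,m}(z)=L^{(-\alpha)}_m(z)$ and $A^{\mathrm{II}}_{\alpha,m}[y]=z\,\eta_{\alpha,m}\,y'+(\alpha-m)\,\eta_{\alpha+1,m}\,y$. For $n\ge m\ge0$ and $j=n-m$, the degree $n$ type II exceptional Laguerre polynomial is $L^{\mathrm{II}(\alpha)}_{m,n}=-A^{\mathrm{II}}_{\alpha+1,m}\big[L^{(\alpha+1)}_{j}\big]$, i.e. $L^{\mathrm{II}(\alpha)}_{m,n}(z)=z\,L^{(-\alpha-1)}_m(z)L^{(\alpha+2)}_{j-1}(z)+(m-\alpha-1)L^{(-\alpha-2)}_m(z)L^{(\alpha+1)}_j(z)$. Its real positive zeros are called regular; its negative and complex zeros are called exceptional. *)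

(* Defs.v *)
(* Real numbers are an arbitrary MathComp-Analysis R : realType. *)
From mathcomp Require Import all_boot all_order all_algebra.
From mathcomp Require Import reals.
From mathcomp Require Import ring.

Set Implicit Arguments.
Unset Strict Implicit.
Unset Printing Implicit Defensive.

Import Order.TTheory GRing.Theory Num.Theory.
Local Open Scope ring_scope.

(* a (a - 1) ... (a - k + 1) / k!, for an arbitrary real a *)
Definition gbinom (R : realType) (a : R) (k : nat) : R :=
  (\prod_(i < k) (a - i%:R)) / k`!%:R.

Definition laguerre (R : realType) (alpha : R) (n : nat) : {poly R} :=
  \sum_(k < n.+1)
    (gbinom (n%:R + alpha) (n - k) / k`!%:R) *: (- 'X) ^+ k.

(* L_{j-1}, with the convention L_{-1} = 0 *)
Definition laguerre_pred (R : realType) (alpha : R) (j : nat) : {poly R} :=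
  if j is i.+1 then laguerre alpha i else 0.

Definition etaII (R : realType) (alpha : R) (m : nat) : {poly R} :=
  laguerre (- alpha) m.

Definition AII (R : realType) (alpha : R) (m : nat) (y : {poly R}) : {poly R} :=
  'X * etaII alpha m * y^`() + (alpha - m%:R) *: (etaII (alpha + 1) m * y).

(* Meaningful for m <= n only: n - m is truncated. *)
Definition xlaguerreII (R : realType) (alpha : R) (m n : nat) : {poly R} :=
  - AII (alpha + 1) m (laguerre (alpha + 1) (n - m)).

Definition regular_zero (R : realType) (p : {poly R}) : pred R :=
  [pred x | (0 < x) && root p x].

Lemma deriv_laguerre (R : realType) (alpha : R) (j : nat) :
  (laguerre alpha j)^`() = - laguerre_pred (alpha + 1) j.
Proof.
rewrite /laguerre raddf_sum big_ord_recl /= expr0 derivZ derivC scaler0 add0r.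
case: j => [|j] /=; first by rewrite big_ord0 oppr0.
rewrite /laguerre -sumrN; apply: eq_bigr => i _.
rewrite derivZ /bump /= add1n deriv_exp derivN derivX /= mulN1r subSS.
rewrite -natr1 -addrA [1 + alpha]addrC mulNrn -scaler_nat !scalerN scalerA.
congr (- (_ *: _)); rewrite factS natrM.
have h1 : i`!%:R != 0 :> R by rewrite pnatr_eq0 -lt0n fact_gt0.
have h2 : i.+1%:R != 0 :> R by rewrite pnatr_eq0.
by field; rewrite h1 nat1r h2.
Qed.

Lemma xlaguerreIIE (R : realType) (alpha : R) (m n : nat) :
  xlaguerreII alpha m n =
    'X * laguerre (- alpha - 1) m * laguerre_pred (alpha + 2%:R) (n - m)
    + (m%:R - alpha - 1) *:
        (laguerre (- alpha - 2%:R) m * laguerre (alpha + 1) (n - m)).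
Proof.
rewrite /xlaguerreII /AII /etaII deriv_laguerre.
have -> : alpha + 1 + 1 = alpha + 2%:R by ring.
have -> : - (alpha + 1) = - alpha - 1 by ring.
have -> : - (alpha + 2%:R) = - alpha - 2%:R by ring.
rewrite mulrN opprD opprK -scaleNr; congr (_ + _ *: _); ring.
Qed.

(* Main.v *)
(**
  Put a = alpha + 1 > m, y = L_j^(a), eta = L_m^(-a), and W = A[y], so that
  the polynomial of the theorem is -W.  On [0, oo) the polynomials eta and
  L_m^(-a-1) have no zero and the constant sign (-1)^m.  The contiguity
  relations give W = z eta y' + (a eta - z eta') y and, from the two Laguerre
  equations, W' = W - (a + j - m) y eta.

  Lower bound: at 0 and at the j positive roots of y, W has, up to a factor of
  constant sign, the values of (z y)', which alternate; hence j sign changes.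

  Upper bound: between two zeros of W, Rolle's theorem for e^(-z) W gives a
  zero of W' - W, hence of y; and past the last root of y, W cannot vanish
  because y and y' have the same sign there.  A positive zero of W is not a
  root of y, so W' does not vanish at it and it is simple.
*)
Require Import Defs.
From mathcomp Require Import all_boot all_order all_algebra.
From mathcomp Require Import reals.
From mathcomp Require Import functions topology normedtype derive sequences exp.
From mathcomp Require Import polyrcf ring lra.

Set Implicit Arguments.
Unset Strict Implicit.
Unset Printing Implicit Defensive.

Import Order.TTheory GRing.Theory Num.Theory.
Import numFieldNormedType.Exports.
Local Open Scope ring_scope.

Local Notation prodXsubC s := (\prod_(x <- s) ('X - x%:P)).

(** * Binomial coefficients and contiguity relations *)

Lemma gbinomS (R : realType) (a : R) (k : nat) :
  k.+1%:R * gbinom a k.+1 = (a - k%:R) * gbinom a k.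
Proof.
rewrite /gbinom big_ord_recr /= factS natrM.
have h1 : k`!%:R != 0 :> R by rewrite pnatr_eq0 -lt0n fact_gt0.
have h2 : k.+1%:R != 0 :> R by rewrite pnatr_eq0.
by field; rewrite h1 nat1r h2.
Qed.

(** Both sides are a(a-1)...(a-k)/k!, with the first or the last factor split off. *)
Lemma gbinom_pred (R : realType) (a : R) (k : nat) :
  a * gbinom (a - 1) k = (a - k%:R) * gbinom a k.
Proof.
rewrite /gbinom !mulrA; congr (_ / _).
rewrite [RHS]mulrC -(big_ord_recr _ (fun i => a - (i : nat)%:R)) big_ord_recl /=.
by rewrite subr0; congr (_ * _); apply: eq_bigr => i _; rewrite /bump add1n -natr1; ring.
Qed.

Lemma coef_laguerre (R : realType) (c : R) (n k : nat) :
  (laguerre c n)`_k =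
    if (k <= n)%N then gbinom (n%:R + c) (n - k) / k`!%:R * (-1) ^+ k else 0.
Proof.
have -> : laguerre c n =
    \poly_(i < n.+1) (gbinom (n%:R + c) (n - i) / i`!%:R * (-1) ^+ i).
  rewrite poly_def; apply: eq_bigr => i _.
  rewrite -[RHS]scalerA; congr (_ *: _).
  by rewrite -mul_polyC polyC_exp polyCN -exprMn mulN1r.
by rewrite coef_poly ltnS.
Qed.

(** The operator on the right multiplies the coefficient of z^k by k + c, which is the factor that
    [gbinom_pred] produces at index n - k. *)
Lemma laguerre_down (R : realType) (c : R) (n : nat) :
  (n%:R + c) *: laguerre (c - 1) n =
    'X * (laguerre c n)^`() + c *: laguerre c n.
Proof.
apply/polyP => k; rewrite coefD !coefZ coefXM coef_deriv !coef_laguerre.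
case: k => [|k] /=.
  have := gbinom_pred (n%:R + c) n; rewrite subn0 -addrA fact0 => H.
  by rewrite expr0 !mulr1 !divr1 H; ring.
case: ifP => [lkn|_]; last by rewrite mul0rn; ring.
have := gbinom_pred (n%:R + c) (n - k.+1); rewrite -addrA natrB // => H.
rewrite -[X in _ = X + _]mulr_natl; move: (gbinom _ _) (gbinom _ _) H => g g' H.
by rewrite !mulrA H; ring.
Qed.

(** The raising relation: the right side is z^(-c) e^z (z^(c+1) e^(-z) y)' for y = L_n^(c+1). It
    yields both the differential equation and the induction on roots. *)
Lemma laguerre_up (R : realType) (c : R) (n : nat) :
  n.+1%:R *: laguerre c n.+1 =
    'X * (laguerre (c + 1) n)^`() + ((c + 1)%:P - 'X) * laguerre (c + 1) n.
Proof.
rewrite mulrBl.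
apply/polyP => k; rewrite coefD coefB coefCM.
rewrite !coefZ !coefXM coef_deriv !coef_laguerre.
have -> : n.+1%:R + c = n%:R + (c + 1) by rewrite -natr1; ring.
case: k => [|k] /=.
  have := gbinomS (n%:R + (c + 1)) n; rewrite !subn0 fact0 => H.
  by rewrite expr0 !mulr1 !divr1 H; ring.
rewrite ltnS subSS.
have h1 : k`!%:R != 0 :> R by rewrite pnatr_eq0 -lt0n fact_gt0.
have h2 : 1 + k%:R != 0 :> R by rewrite nat1r pnatr_eq0.
(* At z^(k+1), everything vanishes for k > n and only -z y contributes for k = n. For k < n, with d
   = n - k - 1, the binomials have indices d and d + 1, related by [gbinomS]. *)
case: (ltngtP k n) h1 h2 => [/subnKC <-|_|->] h1 h2; last 2 first.
- by rewrite mul0rn; ring.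
- rewrite subnn factS natrM exprS /gbinom big_ord0 fact0 mul0rn.
  by field; rewrite h2 h1.
move: (n - k.+1)%N => d; have H := gbinomS ((k.+1 + d)%:R + (c + 1)) d.
have -> : (k.+1 + d - k)%N = d.+1 by rewrite addSnnS addKn.
rewrite addKn factS natrM exprS -[X in _ = X + _]mulr_natl.
have En : (k.+1 + d)%:R = 1 + k%:R + d%:R :> R by rewrite natrD nat1r.
move: H; rewrite -[(k.+1 + d).+1%:R]nat1r En.
move: (gbinom _ d) (gbinom _ d.+1) => g' g.
rewrite -!nat1r => H.
have d0 : 1 + d%:R != 0 :> R by rewrite nat1r pnatr_eq0.
have -> : g = (1 + k%:R + d%:R + (c + 1) - d%:R) * g' / (1 + d%:R).
  by rewrite -H; field.
by field; rewrite d0 h1 h2.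
Qed.

(** * Weighted Rolle theorem and differential equations *)

Lemma rolle_deriv_eq (R : realType) (p : {poly R}) (a b : R) :
  a < b -> root p a -> root p b -> exists2 z, a < z < b & p^`().[z] = p.[z].
Proof.
move=> ltab /rootP pa /rootP pb.
pose f := horner p * (expR \o -%R) : R -> R.
have df (x : R) :
    is_derive x 1 f (p.[x] *: (expR (- x) * -1) + expR (- x) *: p^`().[x]).
  apply: is_deriveM.
have [||| z] := @Rolle R f a b ltab.
- by move=> x _; apply: ex_derive.
- apply: derivable_within_continuous => x _; exact: ex_derive.
- by rewrite /f !fctE pa pb !mul0r.
rewrite in_itv /= => azb dfz; exists z => //.
have := @derive_val _ _ _ _ _ _ _ dfz; rewrite (@derive_val _ _ _ _ _ _ _ (df z)).
rewrite /GRing.scale /= => /eqP.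
rewrite (_ : _ + _ = expR (- z) * (p^`().[z] - p.[z])); last by ring.
by rewrite mulf_eq0 gt_eqF ?expR_gt0 //= subr_eq0 => /eqP.
Qed.

(** Differentiation lowers the degree and raises c by one; [laguerre_up] undoes both, at the cost of
    the factor n. *)
Lemma laguerre_ode (R : realType) (c : R) (n : nat) :
  'X * ((laguerre c n)^`())^`() + ((c + 1)%:P - 'X) * (laguerre c n)^`() =
  - (n%:R *: laguerre c n).
Proof.
rewrite deriv_laguerre; case: n => [|n] /=.
  by rewrite oppr0 deriv0 !mulr0 addr0 scale0r oppr0.
by rewrite derivN laguerre_up; ring.
Qed.

(** [laguerre_down] at -a removes the shifted eta, so that only one eta and its equation enter the
    derivative of W. *)
Lemma AII_etaIIE (R : realType) (a : R) (m : nat) (y : {poly R}) :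
  AII a m y =
  'X * etaII a m * y^`() + (a *: etaII a m - 'X * (etaII a m)^`()) * y.
Proof.
rewrite /AII /etaII scalerAl opprD -[a - _]opprB scaleNr laguerre_down scaleNr.
by congr (_ + _ * _); ring.
Qed.

Lemma deriv_AII_laguerre (R : realType) (a : R) (m j : nat) :
  (AII a m (laguerre a j))^`() =
  AII a m (laguerre a j)
  - (a + j%:R - m%:R) *: (laguerre a j * etaII a m).
Proof.
have Hy := laguerre_ode a j; have He := laguerre_ode (- a) m.
rewrite AII_etaIIE /etaII; move: (laguerre _ m) (laguerre _ j) Hy He => e y.
rewrite !(derivD, derivN, derivM, derivZ, derivX) -!mul_polyC.
rewrite !(polyCD, polyCN) polyC1.
move: (e^`()^`()) (y^`()^`()) => e2 y2 Hy He.
(* Zero is written as t - t, where t is eta times the equation of y minus y times the equation of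
   eta. Expanding one copy through the equations eliminates both second derivatives. *)
apply/eqP; rewrite -subr_eq0
  -[X in _ == X](subrr (e * - (j%:R%:P * y) - y * - (m%:R%:P * e))).
rewrite -{1}Hy -{1}He; apply/eqP; ring.
Qed.

(** * Signs and leading coefficients *)

Lemma sign_gbinom_gt0 (R : realType) (b : R) (k : nat) :
  b < 0 -> 0 < (-1) ^+ k * gbinom b k.
Proof.
move=> b0; rewrite /gbinom mulrA -{1}[k]card_ord -prodrN.
rewrite divr_gt0 ?ltr0n ?fact_gt0 //; apply: prodr_gt0 => i _.
by rewrite opprB subr_gt0 (lt_le_trans b0).
Qed.

Lemma coef_laguerre_diag (R : realType) (c : R) (n : nat) :
  (laguerre c n)`_n = (-1) ^+ n / n`!%:R.
Proof. by rewrite coef_laguerre leqnn subnn /gbinom big_ord0 divr1 mul1r mulrC. Qed.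

Lemma size_laguerre (R : realType) (c : R) (n : nat) :
  size (laguerre c n) = n.+1.
Proof.
apply/eqP; rewrite eqn_leq; apply/andP; split.
  by apply/leq_sizeP => k nk; rewrite coef_laguerre leqNgt nk.
rewrite ltnNge; apply/leq_sizeP => /(_ n (leqnn n)) /eqP.
by rewrite coef_laguerre_diag mulf_eq0 signr_eq0 invr_eq0 pnatr_eq0 eqn0Ngt fact_gt0.
Qed.

Lemma lead_coef_laguerre (R : realType) (c : R) (n : nat) :
  lead_coef (laguerre c n) = (-1) ^+ n / n`!%:R.
Proof. by rewrite lead_coefE size_laguerre coef_laguerre_diag. Qed.

(** Since n + c < 0, the binomial at index n - k has sign (-1)^(n-k); with the factor (-1)^k, every
    coefficient has sign (-1)^n. *)
Lemma sign_laguerre_gt0 (R : realType) (c x : R) (n : nat) :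
  n%:R + c < 0 -> 0 <= x -> 0 < (-1) ^+ n * (laguerre c n).[x].
Proof.
move=> nc0 x0.
have pos k : (k <= n)%N -> 0 < (-1) ^+ n * (laguerre c n)`_k.
  move=> kn; rewrite coef_laguerre kn mulrA mulrAC mulrA.
  rewrite -signr_odd -[_ ^+ k]signr_odd -signr_addb -oddB // signr_odd.
  by rewrite divr_gt0 ?ltr0n ?fact_gt0 ?sign_gbinom_gt0.
rewrite horner_coef size_laguerre big_distrr /= big_ord_recl.
rewrite ltr_pwDl ?expr0 ?mulr1 ?pos //.
apply: sumr_ge0 => i _; rewrite mulrA.
by apply: mulr_ge0; rewrite ?exprn_ge0 // ltW // pos // lift0.
Qed.

(** * Increasing lists and interlacing roots *)

Lemma path_lt_uniq (R : realDomainType) (t : R) (s : seq R) : path <%R t s -> uniq s.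
Proof. by move/path_sorted; rewrite lt_sorted_uniq_le => /andP[]. Qed.

(** Successive gaps are disjoint, so one witness from each forms an increasing list. It serves both
    bounds: zeros of W between sign changes, and roots of y between zeros of W. *)
Lemma path_choose (R : realDomainType) (e : rel R) (P : pred R) (t : R) (s : seq R) :
  (forall x y, e x y -> exists2 z, x < z < y & P z) -> path e t s ->
  exists zs, [/\ path <%R t zs, all P zs & size zs = size s].
Proof.
move=> He; elim: s t => [|y s IH] t /=; first by exists [::].
move=> /andP[/He [z /andP[tz zy] Pz] /IH [zs [pz Pzs szs]]].
exists (z :: zs); split => /=; last by rewrite szs.
  by rewrite tz (path_le lt_trans zy).
by rewrite Pz.
Qed.

Lemma horner_prod_XsubC (R : comNzRingType) (s : seq R) (x : R) :
  (prodXsubC s).[x] = \prod_(y <- s) (x - y).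
Proof. by rewrite horner_prod; apply: eq_bigr => y _; rewrite !hornerE. Qed.

(** Induction on the nodes: adding a smaller node t multiplies the derivative at each old node x by
    x - t > 0, so only the pair formed by t and its successor is new. *)
Lemma deriv_prod_XsubC_alternating (R : realFieldType) (t : R) (s : seq R) :
  path <%R t s ->
  path (fun x y =>
    (prodXsubC (t :: s))^`().[x] * (prodXsubC (t :: s))^`().[y] < 0) t s.
Proof.
elim: s t => [//|y s IH] t /andP[ty pys].
have DE x : (prodXsubC [:: t, y & s])^`().[x] =
    (prodXsubC (y :: s)).[x] + (x - t) * (prodXsubC (y :: s))^`().[x].
  by rewrite big_cons derivM derivXsubC mul1r !hornerE.
have ly : all (> y) s by rewrite (order_path_min lt_trans).
apply/andP; split.
  rewrite !DE subrr mul0r addr0 [prodXsubC (y :: s)]big_cons derivM derivXsubC.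
  rewrite mul1r !hornerE subrr !mul0r add0r addr0 !horner_prod_XsubC.
  rewrite mulrCA !mulrA -mulrA -big_split /= nmulr_rlt0; last by nra.
  rewrite big_seq; apply: prodr_gt0 => x /(allP ly) yx.
  by nra.
have py x : x \in y :: s -> (prodXsubC (y :: s)).[x] = 0.
  by rewrite -root_prod_XsubC => /rootP.
have in_gt x : x \in y :: s -> 0 < x - t.
  rewrite inE subr_gt0 => /orP[/eqP -> //|/(allP ly)]; exact: lt_trans.
apply: (sub_in_path (P := mem (y :: s))) (IH _ pys); last exact/allP.
move=> x z xs zs; rewrite !DE !py // !add0r mulrACA.
by move=> D0; rewrite pmulr_rlt0 // mulr_gt0 // in_gt.
Qed.

(** [p] inherits the alternating signs of the derivative of the node polynomial, and the
    intermediate value theorem gives a root in each gap. *)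
Lemma interlacing_roots (R : rcfType) (p : {poly R}) (t : R) (s : seq R) :
  path <%R t s ->
  (forall x, x \in t :: s ->
     exists2 k, 0 < k & p.[x] = k * (prodXsubC (t :: s))^`().[x]) ->
  exists zs, [/\ path <%R t zs, all (root p) zs & size zs = size s].
Proof.
move=> pts Hp.
apply: (path_choose (e := fun x y => (x < y) && (p.[x] * p.[y] < 0))).
  move=> x y /andP[/ltW xy /(poly_ivtoo xy) [z zxy rz]].
  by exists z => //; rewrite in_itv in zxy.
rewrite path_relI pts /=.
apply: (sub_in_path (P := mem (t :: s))) (deriv_prod_XsubC_alternating pts);
  last exact/allP.
move=> x y xs ys.
have [k k0 ->] := Hp x xs; have [l l0 ->] := Hp y ys.
by move=> D0; rewrite mulrACA pmulr_rlt0 // mulr_gt0.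
Qed.

(** * Positive roots of the Laguerre polynomials *)

Lemma exists_gt_all (R : realDomainType) (s : seq R) : exists M, all (< M) s.
Proof.
elim: s => [|x s [M HM]]; first by exists 0.
exists (Num.max (x + 1) M) => /=; rewrite lt_max ltrDl ltr01 /=.
by apply: sub_all HM => y /= yM; rewrite lt_max yM orbT.
Qed.

(** Induction on n for all c at once, since [laguerre_up] builds L_(n+1)^(c) from L_n^(c+1). The
    nodes 0, the n roots of the latter and a large M leave n + 1 gaps. *)
Lemma laguerre_roots (R : realType) (c : R) (n : nat) :
  -1 < c ->
  exists ts : seq R, [/\ path <%R 0 ts, size ts = n &
    laguerre c n = lead_coef (laguerre c n) *: prodXsubC ts].
Proof.
elim: n c => [|n IH] c c1.
  exists [::]; split => //.
  by apply: all_roots_prod_XsubC; rewrite ?size_laguerre ?uniq_rootsE.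
have [|ts [pts sts]] := IH (c + 1); first by lra.
set U := prodXsubC ts => HU.
set l := lead_coef _ in HU.
have l0 : l != 0 by rewrite lead_coef_eq0 -size_poly_eq0 size_laguerre.
pose V := 'X * U^`() + ((c + 1)%:P - 'X) * U.
have HV : n.+1%:R *: laguerre c n.+1 = l *: V.
  by rewrite laguerre_up HU derivZ scalerDr !scalerAr.
have lV : lead_coef (- V) = 1.
  rewrite lead_coefN; apply: (mulfI l0).
  rewrite mulrN -lead_coefZ -HV lead_coefZ /l !lead_coef_laguerre.
  have h1 : n`!%:R != 0 :> R by rewrite pnatr_eq0 -lt0n fact_gt0.
  have h2 : 1 + n%:R != 0 :> R by rewrite nat1r pnatr_eq0.
  by rewrite factS natrM -nat1r exprS; field; rewrite h1 h2.
have [|N HN] := @poly_pinfty_gt_lc _ (- V); first by rewrite lV ltr01.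
(* As V has leading coefficient -1, it is negative at some M beyond all the
   roots of U, which yields the zero of V past the last of them. *)
have [M /= /and3P[NM M0 tsM]] := exists_gt_all [:: N, 0 & ts].
have VM : 0 < (- V).[M] by apply: lt_le_trans (HN _ (ltW NM)); rewrite lV ltr01.
have UM : 0 < U.[M].
  rewrite horner_prod_XsubC big_seq; apply: prodr_gt0 => x /(allP tsM).
  by rewrite subr_gt0.
have [| x | zs [pzs rzs szs]] := @interlacing_roots R (- V) 0 (rcons ts M).
- rewrite rcons_path pts /=.
  by have := mem_last 0 ts; rewrite inE => /orP[/eqP -> //|/(allP tsM)].
- rewrite inE mem_rcons inE => /or3P xin.
  rewrite big_cons big_rcons /= -/U polyC0 subr0.
  rewrite !(derivM, derivXsubC, derivX) /V !hornerE.
  (* The derivative of z (z - M) U is -M U(0) at 0, M U(M) at M and x (x - M) U'(x) at a root x of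
     [U]. Each witness is the quotient of -V by this value; c > -1 makes the first one positive. *)
  case: xin => [/eqP->|/eqP->|xts].
  + by exists ((c + 1) / M); [rewrite divr_gt0 //; lra | field; rewrite gt_eqF].
  + exists ((- V).[M] / (M * U.[M])); first by rewrite divr_gt0 // mulr_gt0.
    by rewrite /V !hornerE; field; rewrite !gt_eqF.
  + have xM : 0 < M - x by rewrite subr_gt0; exact: (allP tsM).
    have -> : U.[x] = 0 by apply/rootP; rewrite root_prod_XsubC.
    exists (M - x)^-1; rewrite ?invr_gt0 //.
    by field; rewrite gt_eqF.
exists zs; split => //; first by rewrite szs size_rcons sts.
apply: all_roots_prod_XsubC.
- by rewrite size_laguerre szs size_rcons sts.
- apply: sub_all rzs => x; rewrite rootN -(rootZ _ _ l0) -HV rootZ //.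
  by rewrite pnatr_eq0.
- by rewrite uniq_rootsE; exact: path_lt_uniq pzs.
Qed.

(** * Counting the positive zeros of W *)

Lemma deriv_prod_XsubC_neq0 (R : fieldType) (s : seq R) (x : R) :
  uniq s -> x \in s -> (prodXsubC s)^`().[x] != 0.
Proof.
move=> us xs; rewrite (perm_big _ (perm_to_rem xs)) big_cons /=.
rewrite derivM derivXsubC !hornerE subrr mul0r addr0.
by rewrite -rootE root_prod_XsubC mem_rem_uniq // !inE eqxx.
Qed.

Lemma deriv_prod_XsubC_ge0 (R : realDomainType) (s : seq R) (x : R) :
  all (< x) s -> 0 < (prodXsubC s).[x] /\ 0 <= (prodXsubC s)^`().[x].
Proof.
elim: s => [|y s IH] /=; first by rewrite big_nil derivC !hornerE.
rewrite -subr_gt0 => /andP[yx /IH [p0 d0]].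
rewrite big_cons derivM derivXsubC !hornerE mulr_gt0 //.
by rewrite addr_ge0 ?mulr_ge0 // ltW.
Qed.

Lemma mup_simple_root (R : fieldType) (p : {poly R}) (x : R) :
  root p x -> p^`().[x] != 0 -> mup x p = 1%N.
Proof.
move=> /factor_theorem [q ->]; rewrite derivM derivXsubC !hornerE subrr mulr0 add0r.
by move=> qx; rewrite mupMr // -[_ - _]expr1 mup_XsubCX eqxx.
Qed.

Lemma AII_laguerre_zeros (R : realType) (a : R) (m j : nat) :
  m%:R < a -> let p := AII a m (laguerre a j) in
  exists s : seq R, [/\ uniq s, s =i regular_zero p, size s = j
    & forall x, x \in s -> p^`().[x] != 0].
Proof.
move=> ma p.
have a0 : 0 < a by apply: le_lt_trans ma.
have [|ts [pts sts]] := @laguerre_roots R a j; first by lra.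
set U := prodXsubC ts; set l := lead_coef _ => HU.
have l0 : l != 0 by rewrite lead_coef_eq0 -size_poly_eq0 size_laguerre.
pose h x := (-1) ^+ m * (etaII a m).[x].
have h_gt0 x : 0 <= x -> 0 < h x by move=> x0; apply: sign_laguerre_gt0 => //; lra.
pose h1 x := (-1) ^+ m * (etaII (a + 1) m).[x].
have h1_gt0 x : 0 <= x -> 0 < h1 x by move=> x0; apply: sign_laguerre_gt0 => //; lra.
have sgK : (-1) ^+ m * (-1) ^+ m = 1 :> R by rewrite -exprMn mulrNN mulr1 expr1n.
(* This factor makes y monic and turns the two eta into [h] and [h1], positive on [0, oo); the zeros
   are unchanged. *)
pose p1 : {poly R} := ((-1) ^+ m / l) *: p.
have s0 : (-1) ^+ m / l != 0 by rewrite mulf_neq0 ?signr_eq0 ?invr_eq0.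
have p1E x : p1.[x] = x * h x * U^`().[x] + (a - m%:R) * h1 x * U.[x].
  rewrite /p1 /p /AII HU derivZ /h /h1.
  by rewrite !(hornerD, hornerN, hornerM, hornerZ, hornerX); field.
have p1E0 x : p1.[x] =
    x * h x * U^`().[x] + (a * h x - x * ((-1) ^+ m * (etaII a m)^`().[x])) * U.[x].
  rewrite /p1 /p AII_etaIIE HU derivZ /h.
  by rewrite !(hornerD, hornerN, hornerM, hornerZ, hornerX); field.
have ts_gt0 x : x \in ts -> 0 < x by apply/allP; rewrite (order_path_min lt_trans).
have uts : uniq ts by exact: path_lt_uniq pts.
have Uts x : (U.[x] == 0) = (x \in ts) by rewrite -rootE root_prod_XsubC.
have rp x : root p x = (p1.[x] == 0) by rewrite -rootE rootZ.
have dp x : p^`().[x] = p.[x] - (a + j%:R - m%:R) * l * (-1) ^+ m * U.[x] * h x.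
  rewrite deriv_AII_laguerre -/p HU !(hornerD, hornerN, hornerM, hornerZ).
  rewrite [X in _ = _ - X](_ : _ = (a + j%:R - m%:R) * l * U.[x]
    * (etaII a m).[x] * ((-1) ^+ m * (-1) ^+ m)); last by rewrite /h; ring.
  by rewrite sgK; ring.
(* Otherwise mulf_eq0 and hornerE see through h, h1 and p1. *)
clearbody h h1 p1.
have p_notin x : 0 < x -> root p x -> x \notin ts.
  move=> x0; rewrite rp p1E; apply: contraTN => xts.
  have /eqP-> : U.[x] == 0 by rewrite Uts.
  have hx : h x != 0 by rewrite gt_eqF // h_gt0 // ltW.
  have dUx : U^`().[x] != 0 by apply: deriv_prod_XsubC_neq0.
  by rewrite mulr0 addr0 !mulf_eq0 !negb_or hx dUx gt_eqF.
have am0 : a + j%:R - m%:R != 0.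
  by rewrite gt_eqF //; have := ler0n R j; lra.
have p_simple x : 0 < x -> root p x -> p^`().[x] != 0.
  move=> x0 px; rewrite dp (rootP px) sub0r oppr_eq0.
  have hx : h x != 0 by rewrite gt_eqF // h_gt0 // ltW.
  by rewrite !mulf_eq0 !negb_or am0 l0 signr_eq0 hx Uts p_notin.
(* The node polynomial is z U. Its derivative is U(0) at 0, where [p1] is a h(0) U(0), and x U'(x)
   at a root x of [U], where [p1] is x h(x) U'(x). *)
have [//|x|s [ps rs ss]] := @interlacing_roots R p1 0 ts.
  rewrite big_cons polyC0 subr0 derivM derivX !hornerE -/U inE => xin.
  case: (eqVneq x 0) xin => [->|_ /= xts].
    exists (a * h 0); first by rewrite mulr_gt0 ?h_gt0.
    by rewrite p1E0; ring.
  exists (h x); first by rewrite h_gt0 // ltW // ts_gt0.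
  have /eqP U0 : U.[x] == 0 by rewrite Uts.
  by rewrite p1E U0; ring.
have us : uniq s by exact: path_lt_uniq ps.
have s_gt0 x : x \in s -> 0 < x by apply/allP; rewrite (order_path_min lt_trans).
have s_reg x : x \in s -> regular_zero p x.
  by move=> xs; rewrite /regular_zero /= s_gt0 // rp -rootE (allP rs).
have between x y : 0 < x -> root p x -> root p y -> x < y ->
    has (fun z => x < z < y) ts.
  move=> x0 px py xy; have [z xzy] := rolle_deriv_eq xy px py.
  rewrite dp => /eqP; rewrite -subr_eq0 addrAC subrr sub0r oppr_eq0.
  have /andP[xz _] := xzy; have z0 := lt_trans x0 xz.
  rewrite !mulf_eq0 (negPf am0) (negPf l0) signr_eq0 Uts (gt_eqF (h_gt0 _ (ltW z0))).
  by rewrite orbF /= => zts; apply/hasP; exists z.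
have beyond x : 0 < x -> root p x -> has (> x) ts.
  move=> x0 px; apply/negPn/negP; rewrite -all_predC => /allP Hall.
  have ltx : all (< x) ts.
    apply/allP => z zts; rewrite /= lt_neqAle.
    have := Hall z zts; rewrite /= -leNgt => ->; rewrite andbT.
    by apply: contraTneq zts => ->; exact: p_notin.
  have [U0 dU0] := deriv_prod_XsubC_ge0 ltx.
  move: px; rewrite rp p1E gt_eqF // ltr_wpDl //.
    by rewrite !mulr_ge0 // ltW // h_gt0 // ltW.
  by rewrite !mulr_gt0 ?subr_gt0 ?h1_gt0 // ltW.
(* The bound covers any list of distinct zeros, so that it can be applied to [s] extended by a
   supposed further zero. *)
have size_le s' : uniq s' -> {subset s' <= regular_zero p} -> (size s' <= j)%N.
  move=> us' s'reg; rewrite -(size_sort <=%R s').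
  have := sort_lt_sorted s'; rewrite us'.
  have : {subset sort <=%R s' <= regular_zero p}.
    by move=> x; rewrite mem_sort; exact: s'reg.
  case: (sort _ _) => [//|t r] treg srt.
  (* M stands for +oo: the last zero of W is followed by a root of y. *)
  have [M tsM] := exists_gt_all ts.
  pose e x y := has (fun z => x < z < y) ts.
  have [x y /hasP[z zts xzy]||zs [pz zts szs]] :=
    @path_choose R e (mem ts) t (rcons r M).
  - by exists z.
  - rewrite rcons_path; apply/andP; split.
      apply: (sub_in_path (P := mem (t :: r))) srt; last exact/allP.
      move=> x y /treg /andP[x0 px] /treg /andP[_ py] xy.
      exact: between.
    have /treg /andP[x0 px] := mem_last t r.
    have /hasP[z zts xz] := beyond _ x0 px.
    by apply/hasP; exists z => //; rewrite xz; exact: (allP tsM).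
  (* [rcons r M] is as long as [t :: r], so there are as many chosen roots of y as zeros of W. *)
  - rewrite -sts /= -(size_rcons r M) -szs; apply: uniq_leq_size; last exact/allP.
    exact: path_lt_uniq pz.
exists s; split=> //; last 2 first.
- by rewrite ss.
- by move=> x /s_reg /andP[x0 px]; exact: p_simple.
move=> x; apply/idP/idP => [/s_reg //|xreg].
apply/negPn/negP => xs.
suff: (size (x :: s) <= j)%N by rewrite /= ss sts ltnn.
apply: size_le => [|y]; first by rewrite /= xs.
by rewrite inE => /orP[/eqP->|/s_reg].
Qed.

Theorem proposition4p3 (R : realType) (m n : nat) (alpha : R)
    (halpha : m%:R - 1 < alpha) (hmn : (m <= n)%N) :
  exists s : seq R,
    [/\ uniq s,
        s =i regular_zero (xlaguerreII alpha m n),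
        size s = (n - m)%N
      & (\sum_(x <- s) mup x (xlaguerreII alpha m n) = n - m)%N].
Proof.
have [|s [us sreg ss ds]] := @AII_laguerre_zeros R (alpha + 1) m (n - m);
  first by lra.
exists s; split => //.
  by move=> x; rewrite sreg !inE /xlaguerreII rootN.
(* The count with multiplicity agrees with the number of distinct zeros because each summand is
   1. *)
rewrite -[RHS]ss -sum1_size big_seq [RHS]big_seq; apply: eq_bigr => x xs.
apply: mup_simple_root; last by rewrite derivN hornerN oppr_eq0 ds.
by move: xs; rewrite sreg rootN => /andP[].
Qed.
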